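(* Let $X\in\mathcal{X}\subseteq\mathbb{R}$ and $Y\in\mathcal{Y}\subseteq\mathbb{R}$ be random variables such that the conditional pdf of $Y$ given $X$ has the univariate exponential family form $$f_{Y|X}(y|x) = h(y)\, e^{x T(y) - \phi(x)}, \qquad y\in\mathcal{Y},\ x\in\mathcal{X},$$ and assume the regularity conditions (R) listed in the context. Let $K_X(t|Y=y) = \log \mathbb{E}[e^{tX}|Y=y]$ be the conditional cumulant-generating function. For integers $\ell\ge 1$ let $D_y^{(\ell)}$ be the $\ell$-fold composition of the operator $\frac{1}{T'(y)}\frac{\mathrm{d}}{\mathrm{d}y}$, with $D_y^{(0)}=1$ (the identity). Then, for every integer $\ell\ge1$, every $t\in\mathbb{R}$ and every $y\in\mathcal{Y}$ with $T'(y)\neq0$, $$\frac{\mathrm{d}^\ell}{\mathrm{d}t^\ell} K_X(t|Y=y) = D_y^{(\ell)} K_X(t|Y=y) + D_y^{(\ell-1)}\, \mathbb{E}[X|Y=y].$$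
   Context: Exponential family: $T:\mathcal{Y}\to\mathbb{R}$ is the sufficient statistic, $\phi:\mathcal{X}\to\mathbb{R}$ the log-partition function, $h:\mathcal{Y}\to[0,\infty)$ the base measure. Standing assumptions: $\mathcal{Y}$ is open, $h$ is absolutely continuous with respect to Lebesgue measure, and $T$ is analytic, with $T'$ having only isolated zeros (the operator $D_y^{(\ell)}$ is not defined at those zeros). Regularity conditions (R): for every $t\in\mathbb{R}$: $\mathbb{E}[e^{tX} \mid Y=y]<\infty$, $\mathbb{E}[e^{tX}|X| \mid Y=y]<\infty$ and $\mathbb{E}[|X| \mid Y=y]<\infty$ for all $y\in\mathcal{Y}$; and $y\mapsto e^{tx}\,\iota_{P_{X,Y}}(x;y)$ and $y\mapsto f_{Y|X}(y|x)$ are absolutely continuous for every $x$. Here $\iota_{P_{X,Y}}(x;y) = \log\frac{f_{Y|X}(y|x)}{f_Y(y)}$ is the information density, with $f_Y$ the marginal pdf of $Y$. *)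

(* Defs.v *)
From HB Require Import structures.
From mathcomp Require Import all_boot all_order all_algebra.
From mathcomp Require Import all_classical all_reals all_analysis.

Set Implicit Arguments.
Unset Strict Implicit.
Unset Printing Implicit Defensive.

Import Order.TTheory GRing.Theory Num.Theory.
Import numFieldNormedType.Exports.

Local Open Scope classical_set_scope.
Local Open Scope ring_scope.

Section AbsoluteContinuity.
Context {R : realType}.

Definition abs_continuous_itv (a b : R) (g : R -> R) : Prop :=
  forall e : R, 0 < e -> exists2 d : R, 0 < d &
    forall s : seq (R * R),
      (forall p, p \in s -> [/\ a <= p.1, p.1 <= p.2 & p.2 <= b]) ->
      pairwise (fun p q : R * R => (p.2 <= q.1) || (q.2 <= p.1)) s ->
      \sum_(p <- s) (p.2 - p.1) < d ->
      \sum_(p <- s) `|g p.2 - g p.1| < e.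

(* On an open set, absolute continuity is understood locally, i.e. on every
   compact interval contained in the set. *)
Definition abs_continuous_on (D : set R) (g : R -> R) : Prop :=
  forall a b : R, [set` `[a, b]] `<=` D -> abs_continuous_itv a b g.

Definition eabs_continuous_on (D : set R) (g : R -> \bar R) : Prop :=
  (forall y, D y -> g y \is a fin_num) /\ abs_continuous_on D (fine \o g).

End AbsoluteContinuity.

Section Analytic.
Context {R : realType}.

Definition analytic_on (D : set R) (T : R -> R) : Prop :=
  forall y0, D y0 -> exists a : R^nat,
    \forall y \near y0, pseries a (y - y0) @ \oo --> T y.

Definition isolated_zeros_on (D : set R) (g : R -> R) : Prop :=
  forall y0, D y0 -> g y0 = 0 -> \forall y \near y0^', g y != 0.

(* [stat_deriv T l g] is D_y^(l) g; its value at y is meaningful only if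
   T'(y) != 0. *)
Definition stat_deriv (T : R -> R) (l : nat) (g : R -> R) : R -> R :=
  iter l (fun u y => (derive1 T y)^-1 * derive1 u y) g.

End Analytic.

Definition expfam {R : realType} (h T phi : R -> R) (x y : R) : R :=
  h y * expR (x * T y - phi x).

Section Conditional.
Context {d : measure_display} {Om : measurableType d} {R : realType}.
Variables (P : probability Om R) (X Y : {RV P >-> R}) (XX YY : set R).
(* [f x y] stands for f_{Y|X}(y|x); only its values on XX x YY matter. *)
Variable f : R -> R -> R.

Local Notation lambda := (@lebesgue_measure R).

(* The outer integral over P is the integral against the law of X. *)
Definition is_cond_pdf : Prop :=
  [/\ forall x y, XX x -> YY y -> 0 <= f x y,
      forall x, XX x -> measurable_fun YY (f x) /\
        (\int[lambda]_(y in YY) (f x y)%:E = 1)%E,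
      measurable_fun (setT `*` YY) (fun p : Om * R => f (X p.1) p.2) &
      forall A B : set R, measurable A -> measurable B ->
        P (X @^-1` A `&` Y @^-1` B) =
        (\int[P]_(w in X @^-1` A) \int[lambda]_(y in B `&` YY) (f (X w) y)%:E)%E].

Definition marginal_pdf (y : R) : \bar R := 'E_P[fun w => f (X w) y].

(* E[g(X) | Y = y], by Bayes' formula: the conditional law of X given Y = y has
   density f_{Y|X}(y|x) / f_Y(y) with respect to the law of X. This selects the
   version of the conditional expectation that is defined at every y such that
   0 < f_Y(y) < +oo. *)
Definition cond_expect (g : R -> R) (y : R) : \bar R :=
  ('E_P[fun w => (g (X w) * f (X w) y)%R] / marginal_pdf y)%E.

(* This is a real number if and only if f_{Y|X}(y|x) and f_Y(y) are positive and
   f_Y(y) is finite. *)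
Definition info_density (x y : R) : \bar R :=
  lne ((f x y)%:E / marginal_pdf y)%E.

Definition cond_mean (y : R) : R := fine (cond_expect id y).

Definition cond_cgf (t y : R) : R :=
  ln (fine (cond_expect (fun x => expR (t * x)) y)).

Definition regularity : Prop :=
  forall t : R,
    (forall y, YY y ->
       [/\ (cond_expect (fun x => expR (t * x)%R) y < +oo)%E,
           (cond_expect (fun x => (expR (t * x) * `|x|)%R) y < +oo)%E &
           (cond_expect (fun x => `|x|%R) y < +oo)%E]) /\
    (forall x, XX x ->
       eabs_continuous_on YY (fun y => (expR (t * x))%:E * info_density x y)%E /\
       abs_continuous_on YY (f x)).

End Conditional.

(* Main.v *)
(* With G u = E[exp (u X - phi X)] and L = ln G, Bayes' formula makes the factor
   h y cancel, so that K_X(t|Y=y) = L (t + T y) - L (T y) and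
   E[X|Y=y] = L' (T y). The regularity conditions make G finite on the whole
   line, hence G and L are smooth. On functions of the form F (T y), the
   operator (1/T') d/dy acts as F |-> F', so both sides are equal to the l-th
   derivative of L at t + T y. *)
Require Import Defs.
From HB Require Import structures.
From mathcomp Require Import all_boot all_order all_algebra.
From mathcomp Require Import all_classical all_reals all_analysis.
From mathcomp Require Import measurable_realfun ring lra.

Set Implicit Arguments.
Unset Strict Implicit.
Unset Printing Implicit Defensive.

Import Order.TTheory GRing.Theory Num.Theory.
Import numFieldNormedType.Exports.

Local Open Scope classical_set_scope.
Local Open Scope ring_scope.

(** * Power series and differentiability of analytic functions *)

Section PowerSeries.
Context {R : realType}.

(** For [r] strictly between [|x|] and [|K|], the differentiated terms are at most
    [(r - |x|)^-1 * |c n.+1| * r ^+ n.+1], and these are summable because [r] lies inside the disk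
    of convergence. *)
Lemma is_cvg_pseries_diffs (c : R^nat) (K x : R) :
  cvgn (pseries c K) -> `|x| < `|K| -> cvgn (pseries (pseries_diffs c) x).
Proof.
move=> cK xK; pose r := (`|x| + `|K|) / 2.
have [xr rK] : `|x| < r /\ r < `|K| by rewrite /r; split; lra.
have r_ge0 : 0 <= r by exact: ltW (le_lt_trans (normr_ge0 _) xr).
have e_gt0 : 0 < r - `|x| by rewrite subr_gt0.
have cr : cvgn (pseries (fun i => `|c i|) r).
  by apply: is_cvg_pseries_inside_norm cK _; rewrite ger0_norm.
have {}cr : cvgn (series (fun i => `|c i.+1| * r ^+ i.+1)).
  have -> : series (fun i => `|c i.+1| * r ^+ i.+1) =
      (fun n => pseries (fun i => `|c i|) r n.+1 - `|c 0|).
    apply/funext => n; rewrite /pseries /series/= big_nat_recl//=.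
    by rewrite expr0 mulr1 addrAC subrr add0r.
  apply: is_cvgB; last exact: is_cvg_cst.
  by apply/cvg_ex; case/cvg_ex: cr => l crl; exists l; rewrite cvg_shiftS.
apply: normed_cvg.
apply: (@series_le_cvg _ _
  ((r - `|x|)^-1 *: (fun i => `|c i.+1| * r ^+ i.+1))) => [n|n|n|].
- exact: normr_ge0.
- by rewrite /= mulr_ge0 ?invr_ge0 ?(ltW e_gt0)// mulr_ge0// exprn_ge0.
- rewrite /= /pseries_diffs !normrM normrX normr_nat.
  rewrite ler_pdivlMl// mulrCA -mulrA mulrCA ler_wpM2l//.
  rewrite mulrA mulrC.
  (* The left-hand side factors as [r - |x|] times a sum of [n.+1] products
     [r ^+ (n - i) * |x| ^+ i], each at least [|x| ^+ n]. *)
  have : r ^+ n.+1 - `|x| ^+ n.+1 >= (r - `|x|) * (n.+1%:R * `|x| ^+ n).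
    rewrite subrXX ler_wpM2l ?(ltW e_gt0)//.
    have -> : n.+1%:R * `|x| ^+ n = \sum_(i < n.+1) `|x| ^+ n.
      by rewrite sumr_const card_ord mulr_natl.
    apply: ler_sum => i _.
    rewrite -[X in _ ^+ X <= _](subnK (ltn_ord i : (i <= n)%N)) exprD.
    by rewrite ler_wpM2r ?exprn_ge0// lerXn2r ?nnegrE// ltW.
  have : 0 <= `|x| ^+ n.+1 by exact: exprn_ge0.
  by lra.
- exact: is_cvg_seriesZ.
Qed.

Lemma is_cvg_pseries_diffs_disk (c : R^nat) (e : R) :
  (forall x, `|x| < e -> cvgn (pseries c x)) ->
  forall x, `|x| < e -> cvgn (pseries (pseries_diffs c) x).
Proof.
move=> c_cvg x xe; have x0 := normr_ge0 x.
apply: (@is_cvg_pseries_diffs _ ((`|x| + e) / 2)).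
  by apply: c_cvg; rewrite ger0_norm; lra.
by rewrite [ltRHS]ger0_norm; lra.
Qed.

(** Termwise differentiation requires convergence of the series and of its first two formal
    derivatives at some [K] beyond [x]; a midpoint between [|x|] and [e] serves as [K]. *)
Lemma is_derive_pseries (c : R^nat) (e x : R) :
  (forall x, `|x| < e -> cvgn (pseries c x)) -> `|x| < e ->
  is_derive x 1 (fun x => limn (pseries c x))
    (limn (pseries (pseries_diffs c) x)).
Proof.
move=> c_cvg xe; have x0 := normr_ge0 x.
pose K := (`|x| + e) / 2.
have Ke : `|K| < e by rewrite /K ger0_norm; lra.
have xK : `|x| < `|K| by rewrite /K [ltRHS]ger0_norm; lra.
have d1 := is_cvg_pseries_diffs_disk c_cvg.
have d2 := is_cvg_pseries_diffs_disk d1.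
by apply: (@pseries_snd_diffs _ c K) => //; [exact: c_cvg|exact: d1|exact: d2].
Qed.

(** Near [y], [T] is the sum of a power series, so its derivative is again the sum of a power
    series, hence derivable and continuous. Continuity serves to keep [T'] away from 0 near a point
    where it is nonzero. *)
Lemma analytic_on_derivable (D : set R) (T : R -> R) (y : R) :
  analytic_on D T -> D y ->
  (\forall z \near y, derivable T z 1) /\ {for y, continuous (derive1 T)}.
Proof.
move=> aT Dy; have [a] := aT y Dy.
move=> /nbhs_ballP[e /= e0 ae].
have a_cvg x : `|x| < e -> cvgn (pseries a x).
  move=> xe; have : ball y e (y + x).
    by rewrite -ball_normE/= opprD addNKr normrN.
  by move=> /ae; rewrite addrAC subrr add0r => /cvgP.
pose S b (z : R) := limn (pseries b (z - y)).
have S_derive b z : (forall x, `|x| < e -> cvgn (pseries b x)) ->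
    ball y e z -> is_derive z 1 (S b) (S (pseries_diffs b) z).
  move=> b_cvg yz; rewrite -[S (pseries_diffs b) z]mulr1.
  apply: (@is_derive1_comp _ (fun x => limn (pseries b x)) (fun z => z - y)).
    by apply: (is_derive_pseries b_cvg); move: yz;
      rewrite -ball_normE/= distrC.
  by apply: is_derive_eq; rewrite subr0.
have T_derive z : ball y e z -> is_derive z 1 T (S (pseries_diffs a) z).
  move=> yz; apply: (near_eq_is_derive _ (S_derive _ _ a_cvg yz)).
  near=> w; apply/cvg_lim => //; apply: ae.
  by near: w; apply: open_nbhs_nbhs; split => //; exact: ball_open.
split.
  near=> z; have /T_derive[]// : ball y e z by near: z; exact: nbhsx_ballx.
have d_cvg := is_cvg_pseries_diffs_disk a_cvg.
have y_ball := ballxx y e0.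
have T'E z : ball y e z -> derive1 T z = S (pseries_diffs a) z.
  by move=> /T_derive[_ <-]; rewrite derive1E.
have S'_continuous : S (pseries_diffs a) z @[z --> y] --> S (pseries_diffs a) y.
  apply/differentiable_continuous/derivable1_diffP.
  by case: (S_derive _ _ d_cvg y_ball).
have T'near : \forall z \near y, S (pseries_diffs a) z = derive1 T z.
  by near=> z; rewrite T'E//; near: z; exact: nbhsx_ballx.
rewrite /prop_for /continuous_at (T'E y)//.
exact: cvg_trans (near_eq_cvg T'near) S'_continuous.
Unshelve. all: end_near. Qed.
End PowerSeries.

(** * Smooth functions and iterated derivatives *)

Section Smooth.
Context {R : realType}.
Implicit Types f g F L T : R -> R.

Definition smooth f := forall n x, derivable (derive1n n f) x 1.

Lemma smooth_derive1 f : smooth f -> smooth (derive1 f).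
Proof. by move=> sf n x; rewrite -derive1Sn; exact: sf. Qed.

(** This gives smoothness without a formula for the higher derivatives: a class stable under
    derivation suffices. *)
Lemma smooth_closed (S : set (R -> R)) :
  (forall f, S f -> (forall x, derivable f x 1) /\ S (derive1 f)) ->
  S `<=` smooth.
Proof.
move=> Sd f Sf n; suff : S (derive1n n f) by move=> /Sd[].
by elim: n => [//|n IHn]; rewrite derive1nS; have [] := Sd _ IHn.
Qed.

Lemma derive1n_family (F : nat -> R -> R) :
  (forall n (x : R), is_derive x 1 (F n) (F n.+1 x)) ->
  smooth (F 0) /\ forall n, derive1n n (F 0) = F n.
Proof.
move=> F_derive; have FE n : derive1n n (F 0) = F n.
  elim: n => [//|n IHn]; apply/funext => u.
  by rewrite derive1nS IHn derive1E; case: (F_derive n u).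
by split=> // n u; rewrite FE; case: (F_derive n u).
Qed.

Lemma is_derive_derive1n f n (x : R) : smooth f ->
  is_derive x 1 (derive1n n f) (derive1n n.+1 f x).
Proof. by move=> sf; rewrite derive1nS derive1E; exact/derivableP/sf. Qed.

Lemma is_derive_shift f (c x a : R) :
  is_derive (x + c) 1 f a -> is_derive x 1 (fun y => f (y + c)) a.
Proof.
move=> fa; rewrite -[X in is_derive _ _ _ X]mulr1.
apply: (@is_derive1_comp _ f (fun y => y + c)).
by apply: is_derive_eq; rewrite addr0.
Qed.

Lemma smooth_shift_sub L (t : R) : smooth L ->
  smooth (fun u => L (u + t) - L u) /\
  forall n, derive1n n (fun u => L (u + t) - L u) =
            (fun u => derive1n n L (u + t) - derive1n n L u).
Proof.
move=> sL; apply: derive1n_family => n x; apply: is_deriveB.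
  exact/is_derive_shift/is_derive_derive1n.
exact: is_derive_derive1n.
Qed.

Lemma smooth_shift_cst L (c b : R) : smooth L ->
  smooth (fun s => L (s + c) - b) /\
  forall n s, derive1n n.+1 (fun s => L (s + c) - b) s =
    derive1n n.+1 L (s + c).
Proof.
move=> sL.
(* The constant [b] survives only at order 0, hence the formula for orders [n.+1]. *)
pose F n s : R := derive1n n L (s + c) - (if n is 0 then b else 0).
have F_derive n (x : R) : is_derive x 1 (F n) (F n.+1 x).
  by apply: is_deriveB; exact/is_derive_shift/is_derive_derive1n.
have [sF FE] := derive1n_family F_derive.
by split=> // n s; rewrite FE /F subr0.
Qed.

(** By the chain rule each derivation produces a factor [T'], which the operator divides out.
    Openness of [V] matters because the identity at order [k] must hold near [z] before it can be
    differentiated at [z]. *)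
Lemma stat_deriv_comp (V : set R) T F g : open V ->
  (forall z, V z -> derivable T z 1) -> (forall z, V z -> derive1 T z != 0) ->
  smooth F -> (forall z, V z -> g z = F (T z)) ->
  forall k z, V z ->
    derivable (stat_deriv T k g) z 1 /\
    stat_deriv T k g z = derive1n k F (T z).
Proof.
move=> oV T_derivable T'_neq0 sF gE.
have stat_derive k z : V z ->
    (forall w, V w -> stat_deriv T k g w = derive1n k F (T w)) ->
    is_derive z 1 (stat_deriv T k g) (derive1n k.+1 F (T z) * derive1 T z).
  move=> Vz kE; apply: (@near_eq_is_derive _ _ _ ((derive1n k F) \o T)).
    by near=> w; rewrite kE//; near: w; exact: open_nbhs_nbhs.
  apply: is_derive1_comp; rewrite ?derive1nS derive1E; apply/derivableP.
    exact: sF.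
  exact: T_derivable.
have E k : forall z, V z -> stat_deriv T k g z = (derive1n k F) (T z).
  elim: k => [//|k IHk] z Vz.
  have -> : stat_deriv T k.+1 g z =
      (derive1 T z)^-1 * derive1 (stat_deriv T k g) z by [].
  rewrite [X in _ * X]derive1E.
  by have [_ ->] := stat_derive k z Vz IHk; rewrite mulrCA mulVf ?mulr1 ?T'_neq0.
by move=> k z Vz; split; [case: (stat_derive k z Vz (E k))|exact: E].
Unshelve. all: end_near. Qed.

(** * Smoothness of the logarithm of a positive function *)

Section Log.
Variable M : nat -> R -> R.
Hypothesis M_derive : forall k (x : R), is_derive x 1 (M k) (M k.+1 x).
Hypothesis M0_gt0 : forall x, 0 < M 0 x.

(* The algebra generated by the [M k] and the inverse of [M 0] is stable under
   derivation and contains [M 1 / M 0], the derivative of [ln (M 0)]. *)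
Inductive logderiv_alg : (R -> R) -> Prop :=
| logderiv_alg_gen k : logderiv_alg (M k)
| logderiv_alg_inv : logderiv_alg (fun x => (M 0 x)^-1)
| logderiv_alg_opp f : logderiv_alg f -> logderiv_alg (fun x => - f x)
| logderiv_alg_add f g : logderiv_alg f -> logderiv_alg g ->
    logderiv_alg (fun x => f x + g x)
| logderiv_alg_mul f g : logderiv_alg f -> logderiv_alg g ->
    logderiv_alg (fun x => f x * g x).

Lemma logderiv_alg_derive f : logderiv_alg f ->
  exists2 f', logderiv_alg f' & forall x : R, is_derive x 1 f (f' x).
Proof.
elim=> {f} [k||f _ [f' af' ff']|f g af [f' af' ff'] ag [g' ag' gg']
  |f g af [f' af' ff'] ag [g' ag' gg']].
- by exists (M k.+1) => //; exact: logderiv_alg_gen.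
- exists (fun x => - (((M 0 x)^-1 * (M 0 x)^-1) * M 1 x)).
    apply/logderiv_alg_opp/logderiv_alg_mul; last exact: logderiv_alg_gen.
    by apply: logderiv_alg_mul; exact: logderiv_alg_inv.
  move=> x; rewrite -mulNr -invfM -expr2.
  by apply: is_deriveV; rewrite ?gt_eqF.
- exists (fun x => - f' x) => [|x]; first exact: logderiv_alg_opp.
  exact: is_deriveN.
- exists (fun x => f' x + g' x) => [|x]; first exact: logderiv_alg_add.
  exact: is_deriveD.
- exists (fun x => f x * g' x + g x * f' x) => [|x].
    by apply: logderiv_alg_add; exact: logderiv_alg_mul.
  exact: is_deriveM.
Qed.

Lemma smooth_ln : smooth (fun x => ln (M 0 x)) /\
  derive1 (fun x => ln (M 0 x)) = (fun x => M 1 x / M 0 x).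
Proof.
have ln_derive (x : R) : is_derive x 1 (fun x => ln (M 0 x)) (M 1 x / M 0 x).
  rewrite mulrC; apply: (@is_derive1_comp _ (@ln R) (M 0)).
  exact: is_derive1_ln.
have lnE : derive1 (fun x => ln (M 0 x)) = (fun x => M 1 x / M 0 x).
  by apply/funext => x; rewrite derive1E; case: (ln_derive x).
(* Order 0 is treated directly: the algebra is used for the derivative [M 1 / M 0], not for the
   logarithm itself. *)
split=> // -[|n] x; first by case: (ln_derive x).
rewrite derive1Sn lnE; apply: (@smooth_closed logderiv_alg).
  move=> f /logderiv_alg_derive[f' af' ff']; split=> [z|].
    by case: (ff' z).
  suff -> : derive1 f = f' by [].
  by apply/funext => z; rewrite derive1E; case: (ff' z).
by apply: logderiv_alg_mul; [exact: logderiv_alg_gen|exact: logderiv_alg_inv].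
Qed.

End Log.
End Smooth.

(** * Weighted exponential moments and differentiation under the integral *)

Section ExponentialMoments.
Context {d : measure_display} {Om : measurableType d} {R : realType}.
Variables (mu : {measure set Om -> \bar R}) (X W : Om -> R).
Hypotheses (X_meas : measurable_fun setT X) (W_meas : measurable_fun setT W).
Hypothesis W_gt0 : forall w, 0 < W w.
Hypothesis expX_integrable : forall u : R,
  mu.-integrable setT (EFin \o (fun w => expR (u * X w) * W w)).

(** For [k = 0] this is the Laplace transform of [X] under the measure of density [W] with respect
    to [mu]; the other [k] are its successive derivatives. *)
Definition exp_moment (k : nat) (u : R) : R :=
  \int[mu]_w (X w ^+ k * expR (u * X w) * W w).

(** Since [|x| <= expR |x|] and [u * x <= a * x + |x|], the left-hand side is at most
    [expR (a * x + k.+1%:R * |x|)], which is one of the two exponentials according to the sign of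
    [x]. The bound is uniform in [u], as dominated differentiation requires. *)
Lemma ler_powXexp (k : nat) (a u x : R) : `|u - a| <= 1 ->
  `|x ^+ k * expR (u * x)| <=
    expR ((a + k.+1%:R) * x) + expR ((a - k.+1%:R) * x).
Proof.
move=> ua; have x_exp : `|x| <= expR `|x|.
  by apply: le_trans (expR_ge1Dx _); rewrite lerDr.
have ux : u * x <= a * x + `|x|.
  rewrite -lerBlDl -mulrBl (le_trans (ler_norm _))// normrM.
  by rewrite ler_piMl.
have : `|x ^+ k * expR (u * x)| <= expR (k%:R * `|x| + (a * x + `|x|)).
  rewrite normrM normrX (ger0_norm (expR_ge0 _)) expRD.
  apply: ler_pM; rewrite ?exprn_ge0 ?expR_ge0 ?ler_expR// expRM_natl.
  by rewrite lerXn2r ?nnegrE ?expR_ge0.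
move=> /le_trans; apply.
have [x0|x0] := leP 0 x.
  rewrite (_ : _%:R * _ + _ = (a + k.+1%:R) * x) ?lerDl ?expR_ge0//.
  by rewrite ger0_norm// -natr1; ring.
rewrite (_ : _%:R * _ + _ = (a - k.+1%:R) * x) ?lerDr ?expR_ge0//.
by rewrite ltr0_norm// -natr1; ring.
Qed.

Let moment_meas k u :
  measurable_fun setT (fun w => X w ^+ k * expR (u * X w) * W w).
Proof.
apply: measurable_funM => //; apply: measurable_funM.
  exact: measurable_funX.
by apply: measurableT_comp => //; exact: measurable_funM.
Qed.

Let dom k a w :=
  expR ((a + k.+1%:R) * X w) * W w + expR ((a - k.+1%:R) * X w) * W w.

Let dom_integrable k a : mu.-integrable setT (EFin \o dom k a).
Proof.
rewrite (_ : _ \o _ =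
  ((EFin \o (fun w => expR ((a + k.+1%:R) * X w) * W w)%R) \+
   (EFin \o (fun w => expR ((a - k.+1%:R) * X w) * W w)%R))%E).
  by apply: integrableD => //; exact: expX_integrable.
by apply/funext => w.
Qed.

Let ler_dom k a u w : `|u - a| <= 1 ->
  `|X w ^+ k * expR (u * X w) * W w| <= dom k a w.
Proof.
move=> ua; rewrite normrM (ger0_norm (ltW (W_gt0 w))) /dom -mulrDl.
by rewrite ler_wpM2r ?ler_powXexp// ltW.
Qed.

Lemma exp_moment_integrable k u :
  mu.-integrable setT (EFin \o (fun w => X w ^+ k * expR (u * X w) * W w)).
Proof.
apply: (le_integrable measurableT _ _ (dom_integrable k u)).
  exact/measurable_EFinP/moment_meas.
move=> w _ /=; rewrite lee_fin (le_trans (ler_dom k w (u := u) (a := u) _))//.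
  by rewrite subrr normr0.
exact: ler_norm.
Qed.

(** Differentiation under the integral on the unit neighbourhood of [u]: the partial derivative is
    the integrand of order [k.+1], dominated there by the integrable function [dom k.+1 u]. *)
Lemma is_derive_exp_moment k (u : R) :
  is_derive u 1 (exp_moment k) (exp_moment k.+1 u).
Proof.
pose f (u : R) w := X w ^+ k * expR (u * X w) * W w.
have f_derive (v : R) w :
    is_derive v 1 (f ^~ w) (X w ^+ k.+1 * expR (v * X w) * W w).
  have exp_derive :
      is_derive v 1 (fun v => expR (v * X w)) (expR (v * X w) * X w).
    apply: (@is_derive1_comp _ expR (fun v => v * X w)).
    apply: is_derive_eq.
    by rewrite scaler0 add0r [LHS]mulr1.
  have -> : f ^~ w = (X w ^+ k * W w) *: (fun v => expR (v * X w)).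
    by apply/funext => z; rewrite /f mulrAC.
  apply: is_derive_eq.
  by rewrite /GRing.scale/= exprS; ring.
have f_partial v w : partial1of2 f v w = X w ^+ k.+1 * expR (v * X w) * W w.
  by rewrite partial1of2E; case: (f_derive v w).
have uI : `]u - 1, u + 1[%classic u by rewrite /= in_itv/=; lra.
have f_int v : `]u - 1, u + 1[%classic v ->
    mu.-integrable setT (EFin \o f v).
  by move=> _; exact: exp_moment_integrable.
have f_der v w : `]u - 1, u + 1[%classic v -> setT w -> derivable (f ^~ w) v 1.
  by move=> _ _; case: (f_derive v w).
have dom_ge0 w : 0 <= dom k.+1 u w.
  by rewrite addr_ge0// mulr_ge0 ?expR_ge0 ?ltW.
have f_dom v w : `]u - 1, u + 1[%classic v -> setT w ->
    `|partial1of2 f v w| <= dom k.+1 u w.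
  rewrite /= in_itv/= => /andP[uv vu] _; rewrite f_partial ler_dom//.
  by rewrite ler_norml; lra.
split.
  exact: (derivable_under_integral measurableT uI f_int f_der dom_ge0
    (dom_integrable _ _) f_dom).
rewrite -derive1E (differentiation_under_integral measurableT uI f_int f_der
  dom_ge0 (dom_integrable _ _) f_dom).
by apply: eq_Rintegral => w _; rewrite f_partial.
Qed.

Lemma exp_moment0_gt0 (u : R) : mu setT != 0%E -> 0 < exp_moment 0 u.
Proof.
move=> mu0; rewrite lt0r; apply/andP; split; last first.
  apply: Rintegral_ge0 => w _.
  by rewrite expr0 mul1r mulr_ge0 ?expR_ge0 ?ltW.
apply: contra_neq mu0 => Mu0.
have /measurable_EFinP f_meas := moment_meas 0 u.
have int0 : (\int[mu]_w `|(X w ^+ 0 * expR (u * X w) * W w)%:E| = 0)%E.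
  have Mfin := integrable_fin_num measurableT (exp_moment_integrable 0 u).
  rewrite -[RHS]/(0%:E) -Mu0 /exp_moment /Rintegral (fineK Mfin).
  apply: eq_integral => w _; rewrite gee0_abs// lee_fin expr0 mul1r.
  by rewrite mulr_ge0 ?expR_ge0 ?ltW.
have /(ae_eq_integral_abs mu measurableT) := int0.
move=> /(_ f_meas)[N [mN N0 fN]].
(* The integrand vanishes nowhere, so the null set [N] is the whole space. *)
rewrite -N0; congr (mu _); apply/esym/seteqP; split=> // w _; apply: fN => /=.
move=> /(_ I)[] /eqP; rewrite expr0 mul1r mulf_eq0 expR_eq0/=.
by rewrite gt_eqF.
Qed.

End ExponentialMoments.

(** In the extended reals the inverse of 0 is [+oo] and that of [+oo] is 0, so every degenerate case
    gives the logarithm of 0 or of [+oo], which is infinite. *)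
Lemma lne_div_fin_num {R : realType} (a : R) (m : \bar R) :
  0 <= a -> (0 <= m)%E -> lne (a%:E / m)%E \is a fin_num ->
  [/\ 0 < a, (0 < m)%E & m \is a fin_num].
Proof.
move=> a0 m0; have [->|a_neq0] := eqVneq a 0; first by rewrite mul0e le0_lneNy.
have a_gt0 : 0 < a by rewrite lt0r a_neq0.
case: m m0 => [r| |] // r0.
  have [->|r_neq0] := eqVneq r 0.
    by rewrite inver eqxx gt0_muley.
  by move=> _; split=> //; rewrite lte_fin lt0r r_neq0.
by rewrite invey mule0 le0_lneNy.
Qed.

(** * Conditional moments in the exponential family *)

Section ExponentialFamily.
Context {d : measure_display} {Om : measurableType d} {R : realType}.
Variables (P : probability Om R) (X Y : {RV P >-> R}) (XX YY : set R).
Variables (h T phi : R -> R).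
Hypothesis X_in : forall w, XX (X w).
Hypothesis YY_open : open YY.
Hypothesis f_pdf : is_cond_pdf X Y XX YY (expfam h T phi).
Hypothesis f_reg : regularity X XX YY (expfam h T phi).

Local Notation f := (expfam h T phi).
Local Notation W := (fun w => expR (- phi (X w))).
Local Notation M := (exp_moment P X W).

Lemma expfamE y w : f (X w) y = h y * (expR (T y * X w) * W w).
Proof. by rewrite /expfam -expRD mulrC [T y * _]mulrC mulrC. Qed.

(* The finiteness of the information density, for one value of X, is what
   excludes the junk values of [cond_expect]. *)
Lemma marginal_pdf_gt0 y : YY y ->
  [/\ 0 < h y, (0 < marginal_pdf X f y)%E & marginal_pdf X f y \is a fin_num].
Proof.
move=> y_in.
(* Total mass 1 forces a sample point [w0]; the regularity condition is then used at [X w0], with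
   [t = 0] to remove the factor [expR (t * x)]. *)
have /set0P[w0 _] : [set: Om] != set0.
  apply/eqP => Om0; have := probability_setT P; rewrite Om0 measure0.
  by move/eqP; rewrite eqe eq_sym oner_eq0.
have [_ /(_ _ (X_in w0))[[/(_ _ y_in)]]] := f_reg 0.
rewrite mul0r expR0 mul1e => iota_fin _ _.
have f_ge0 w : 0 <= f (X w) y by have [f_ge0 _ _ _] := f_pdf; exact: f_ge0.
have m_ge0 : (0 <= marginal_pdf X f y)%E.
  by rewrite /marginal_pdf; apply: expectation_ge0 => w.
have [] := lne_div_fin_num (f_ge0 w0) m_ge0 iota_fin.
by rewrite /expfam pmulr_lgt0 ?expR_gt0.
Qed.

(** Measurability of [phi] is not assumed; that of [W] is recovered from the density at [y] by
    dividing out [h y] and [expR (T y * X w)]. *)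
Lemma weight_measurable y : YY y -> measurable_fun setT W.
Proof.
move=> y_in; have [h_gt0 _ _] := marginal_pdf_gt0 y_in.
have [_ _ f_meas _] := f_pdf.
have fy_meas : measurable_fun setT (fun w => f (X w) y).
  apply: (measurable_comp _ _ f_meas (g := fun w : Om => (w, y))) => //.
  - by apply: measurableX => //; exact: open_measurable.
  - by move=> _ [w _ <-].
rewrite (_ : (fun w => _) =
    (fun w => (h y)^-1 * f (X w) y * expR (- T y * X w))).
  apply: measurable_funM; first exact: measurable_funM.
  by apply: measurableT_comp => //; exact: measurable_funM.
apply/funext => w; rewrite expfamE mulKf ?gt_eqF// mulrAC -expRD.
by rewrite mulNr subrr expR0 mul1r.
Qed.

(** The regularity condition at parameter [u - T y] applies: the density contributes
    [expR (T y * x)], so the total exponent is [u * x]. *)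
Lemma expX_integrable y (u : R) : YY y ->
  P.-integrable setT (EFin \o (fun w => expR (u * X w) * W w)).
Proof.
move=> y_in; have [h_gt0 m_gt0 m_fin] := marginal_pdf_gt0 y_in.
have X_meas : measurable_fun setT X by [].
have g_meas : measurable_fun setT (fun w => expR (u * X w) * W w).
  apply: measurable_funM; last exact: weight_measurable y_in.
  by apply: measurableT_comp => //; exact: measurable_funM.
have g_ge0 w : 0 <= expR (u * X w) * W w by rewrite mulr_ge0 ?expR_ge0.
have [/(_ _ y_in)[+ _ _] _] := f_reg (u - T y).
rewrite /cond_expect unlock.
under eq_integral => w _.
  rewrite expfamE mulrCA [X in _ * X]mulrA -expRD -mulrDl subrK EFinM.
  over.
rewrite ge0_integralZl_EFin//=; last 2 first.
- exact/measurable_EFinP.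
- exact: ltW.
move=> cond_lty.
apply/integrableP; split; first exact/measurable_EFinP.
under eq_integral do rewrite /= ger0_norm//.
(* An infinite integral would stay infinite after multiplication by [h y > 0] and division by the
   positive finite marginal. *)
rewrite ltNge leye_eq; apply/eqP => int_y; move: cond_lty.
have fm_gt0 : 0 < fine (marginal_pdf X f y).
  by rewrite fine_gt0// m_gt0 ltey_eq m_fin.
rewrite int_y gt0_muley ?lte_fin// -(fineK m_fin) inver gt_eqF//.
by rewrite gt0_mulye ?ltxx// lte_fin invr_gt0.
Qed.

(** The shape of [g] covers the constant 1, the exponential and the identity, that is, the marginal
    density, the generating function and the mean. *)
Lemma expectation_exp_moment y (g : R -> R) k t : YY y ->
  (forall x, g x = x ^+ k * expR (t * x)) ->
  ('E_P[fun w => (g (X w) * f (X w) y)%R])%E = (h y * M k (t + T y))%:E.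
Proof.
move=> y_in gE; have [h_gt0 _ _] := marginal_pdf_gt0 y_in.
have W_meas := weight_measurable y_in.
have X_meas : measurable_fun setT X by [].
have int_M := exp_moment_integrable X_meas W_meas
  (fun w => expR_gt0 (- phi (X w))) (fun u => expX_integrable u y_in).
rewrite EFinM /exp_moment /Rintegral fineK; last first.
  exact: (integrable_fin_num measurableT (int_M k (t + T y))).
rewrite -integralZl//; last exact: int_M.
rewrite unlock; apply: eq_integral => w _; rewrite -EFinM; congr EFin.
by rewrite gE expfamE mulrDl expRD; ring.
Qed.

Lemma marginal_pdfE y : YY y -> marginal_pdf X f y = (h y * M 0 (T y))%:E.
Proof.
move=> y_in; rewrite -[T y]add0r.
rewrite -(@expectation_exp_moment y (cst 1) 0 0 y_in) => [|x].
  by rewrite /marginal_pdf; congr ('E_P[ _ ])%E; apply/funext => w;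
    rewrite mul1r.
by rewrite expr0 mul0r expR0 mulr1.
Qed.

Lemma moment0_gt0 y (u : R) : YY y -> 0 < M 0 u.
Proof.
move=> y_in; apply: exp_moment0_gt0.
- by [].
- exact: weight_measurable y_in.
- by move=> w; exact: expR_gt0.
- by move=> v; exact: expX_integrable y_in.
- by rewrite [X in X != _](probability_setT P) onee_neq0.
Qed.

Lemma cond_expect_exp_moment y (g : R -> R) k t : YY y ->
  (forall x, g x = x ^+ k * expR (t * x)) ->
  cond_expect X f g y = (M k (t + T y) / M 0 (T y))%:E.
Proof.
move=> y_in gE; have [h_gt0 _ _] := marginal_pdf_gt0 y_in.
have M0_gt0 := moment0_gt0 (T y) y_in.
rewrite /cond_expect (expectation_exp_moment y_in gE) marginal_pdfE//.
rewrite inver mulf_eq0 !gt_eqF//= -EFinM; congr EFin.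
by field; rewrite !gt_eqF.
Qed.

Lemma cond_cgfE y t : YY y ->
  cond_cgf X f t y = ln (M 0 (t + T y)) - ln (M 0 (T y)).
Proof.
move=> y_in; rewrite /cond_cgf (@cond_expect_exp_moment y _ 0 t y_in) => [|x].
  by rewrite ln_div// posrE; exact: moment0_gt0 y_in.
by rewrite expr0 mul1r.
Qed.

Lemma cond_meanE y : YY y -> cond_mean X f y = M 1 (T y) / M 0 (T y).
Proof.
move=> y_in; rewrite /cond_mean (@cond_expect_exp_moment y _ 1 0 y_in) => [|x].
  by rewrite add0r.
by rewrite expr1 mul0r expR0 mulr1.
Qed.

End ExponentialFamily.

(** * The derivative identity *)

Theorem theorem4 (R : realType) (d : measure_display) (Om : measurableType d)
    (P : probability Om R) (X Y : {RV P >-> R}) (XX YY : set R)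
    (h T phi : R -> R)
    (X_in : forall w, XX (X w)) (Y_in : forall w, YY (Y w))
    (YY_open : open YY)
    (h_ge0 : forall y, YY y -> 0 <= h y)
    (h_meas : measurable_fun YY h)
    (h_ac : (fun B : set R => \int[@lebesgue_measure R]_(y in B `&` YY) (h y)%:E)%E
            `<< @lebesgue_measure R)
    (T_analytic : analytic_on YY T)
    (T'_zeros : isolated_zeros_on YY (derive1 T))
    (f_pdf : is_cond_pdf X Y XX YY (expfam h T phi))
    (f_reg : regularity X XX YY (expfam h T phi))
    (l : nat) (l_ge1 : (1 <= l)%N) (t y : R) (y_in : YY y)
    (T'y : derive1 T y != 0) :
  let K := cond_cgf X (expfam h T phi) in
  let EX := cond_mean X (expfam h T phi) in
  [/\ forall k, (k < l)%N -> derivable (derive1n k (fun s => K s y)) t 1,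
      forall k, (k < l)%N -> derivable (stat_deriv T k (K t)) y 1,
      forall k, (k < l.-1)%N -> derivable (stat_deriv T k EX) y 1 &
      derive1n l (fun s => K s y) t =
        stat_deriv T l (K t) y + stat_deriv T l.-1 EX y].
Proof.
move=> K EX; pose M := exp_moment P X (fun w => expR (- phi (X w))).
pose L u := ln (M 0 u).
have M_derive k (u : R) : is_derive u 1 (M k) (M k.+1 u).
  apply: is_derive_exp_moment.
  - by [].
  - exact: weight_measurable f_pdf f_reg _ y_in.
  - by move=> w; exact: expR_gt0.
  - by move=> v; exact: expX_integrable f_pdf f_reg _ _ y_in.
have M0_gt0 u : 0 < M 0 u by exact: moment0_gt0 f_pdf f_reg _ _ y_in.
have [sL L'E] := smooth_ln M_derive M0_gt0.
have KE s z : YY z -> K s z = L (s + T z) - L (T z).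
  exact: cond_cgfE f_pdf f_reg _ _.
have EXE z : YY z -> EX z = derive1 L (T z).
  by rewrite L'E; exact: cond_meanE f_pdf f_reg _.
have [sKy KyE] := smooth_shift_cst (T y) (L (T y)) sL.
have [sF FE] := smooth_shift_sub t sL.
have [T_near T'_cont] := analytic_on_derivable T_analytic y_in.
(* Taking the interior yields the open set on which the iterated operator is computed; continuity of
   [T'] at [y] puts [y] in it. *)
pose V := [set z | [/\ YY z, derivable T z 1 & derive1 T z != 0]]°.
have Vy : V y.
  rewrite /V /interior; near=> z; split.
  - by near: z; exact: open_nbhs_nbhs.
  - by near: z.
  - near: z; exact: (cvgr_neq0 _ T'_cont T'y).
have oV : open V by exact: open_interior.
have VP z : V z -> [/\ YY z, derivable T z 1 & derive1 T z != 0].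
  by move=> /interior_subset.
have VT z : V z -> derivable T z 1 by move=> /VP[].
have VT' z : V z -> derive1 T z != 0 by move=> /VP[].
have KV z : V z -> K t z = L (T z + t) - L (T z).
  by move=> /VP[z_in _ _]; rewrite KE// [t + _]addrC.
have EXV z : V z -> EX z = derive1 L (T z) by move=> /VP[z_in _ _]; exact: EXE.
have K_stat := stat_deriv_comp oV VT VT' sF KV.
have EX_stat := stat_deriv_comp oV VT VT' (smooth_derive1 sL) EXV.
have -> : (fun s => K s y) = (fun s => L (s + T y) - L (T y)).
  by apply/funext => s; exact: KE.
split=> [k _|k _|k _|].
- exact: sKy.
- by have [] := K_stat k y Vy.
- by have [] := EX_stat k y Vy.
- have [_ ->] := K_stat l y Vy; have [_ ->] := EX_stat l.-1 y Vy.
  (* With [l = n.+1], the operator on [K t] leaves the term [- derive1n n.+1 L (T y)], which the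
     [n]-th derivative of [derive1 L], coming from the mean, cancels. *)
  case: l l_ge1 => // n _; rewrite KyE FE -derive1Sn subrK.
  by rewrite addrC.
Unshelve. all: end_near. Qed.
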